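(* Let $F$ be a finite field of characteristic $2$, let $A=(a_{ij})_{1\le i,j\le 3}$ be a $3\times 3$ matrix over $F$ with $a_{12}a_{23}a_{31}\ne a_{13}a_{32}a_{21}$, and let $R$ be the $2\times2\times2$ block made of copies of $A$. Then, in the bases $\{\mathsf f^{(i)},\mathsf e_1^{(i)},\mathsf e_2^{(i)},\mathsf e_3^{(i)}\}$ of the three thick spaces $\mathbf V_i$, $i=1,2,3$, given in the context, $R$ is represented as the direct sum $$\begin{pmatrix} a_{11}^2 & a_{21}^2 & a_{31}^2 \\ a_{12}^2 & a_{22}^2 & a_{32}^2 \\ a_{13}^2 & a_{23}^2 & a_{33}^2 \end{pmatrix}\;\oplus\;\mathbf 1_3\otimes\begin{pmatrix} a_{11}^2 & a_{12}^2 & a_{13}^2 \\ a_{21}^2 & a_{22}^2 & a_{23}^2 \\ a_{31}^2 & a_{32}^2 & a_{33}^2 \end{pmatrix},$$ where the first summand acts in the span of $\mathsf f^{(1)},\mathsf f^{(2)},\mathsf f^{(3)}$, and $\mathbf 1_3\otimes(\cdot)$ denotes the direct sum of three copies, acting in the spans of $\mathsf e_s^{(1)},\mathsf e_s^{(2)},\mathsf e_s^{(3)}$ for $s=1,2,3$. That is, for all $i$ and $s$, $\mathsf f^{(i)}R=\sum_{j=1}^3 a_{ji}^2\,\mathsf f^{(j)}$ and $\mathsf e_s^{(i)}R=\sum_{j=1}^3 a_{ij}^2\,\mathsf e_s^{(j)}$.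
   Context: Conventions: vectors are rows and operators/matrices act from the right, so in a product the leftmost factor is applied first. Block. Let $C=\{0,1\}^3\subset\mathbb Z^3$. To every straight line parallel to the $i$-th axis through points of $C$ attach a copy of $V_i=F$. To every $\mathbf x\in C$ attach a copy $A^{(\mathbf x)}$ of $A$ acting in the direct sum of the copies of $V_1,V_2,V_3$ attached to the three lines meeting at $\mathbf x$, extended by the identity to the other copies. The $2\times2\times2$ block is $R=\prod_{\mathbf x\in C}A^{(\mathbf x)}$, in any order such that $A^{(\mathbf x)}$ stands to the left of $A^{(\mathbf y)}$ whenever $\mathbf x\ne\mathbf y$ and $x_i\le y_i$ for all $i$ (the result does not depend on this choice). The thick space $\mathbf V_i$ is the direct sum of the four copies of $V_i$ attached to lines parallel to the $i$-th axis; $R$ acts in $\mathbf V_1\oplus\mathbf V_2\oplus\mathbf V_3$. The four coordinates in $\mathbf V_i$ correspond to the lines ordered lexicographically, $(0,0),(0,1),(1,0),(1,1)$, by their two constant coordinates taken in increasing order of axis number: $(x_2,x_3)$ for $\mathbf V_1$, $(x_1,x_3)$ for $\mathbf V_2$, $(x_1,x_2)$ for $\mathbf V_3$. Vectors (rows of length 4). In $\mathbf V_1$: $\mathsf f^{(1)}=\bigl(a_{21}a_{31},\ a_{31}(a_{21}a_{33}+a_{23}a_{31}),\ a_{21}(a_{21}a_{32}+a_{22}a_{31}),\ (a_{21}a_{33}+a_{23}a_{31})(a_{21}a_{32}+a_{22}a_{31})\bigr)$, $\mathsf e_1^{(1)}=(0,0,a_{12},a_{12}a_{33}+a_{13}a_{32})$,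 $\mathsf e_2^{(1)}=(0,a_{13},0,a_{12}a_{23}+a_{13}a_{22})$, $\mathsf e_3^{(1)}=(1,a_{33},a_{22},a_{22}a_{33}+a_{23}a_{32})$. In $\mathbf V_2$: $\mathsf f^{(2)}=\bigl(a_{12}a_{32},\ a_{32}(a_{12}a_{33}+a_{13}a_{32}),\ a_{12}(a_{11}a_{32}+a_{12}a_{31}),\ (a_{12}a_{33}+a_{13}a_{32})(a_{11}a_{32}+a_{12}a_{31})\bigr)$, $\mathsf e_1^{(2)}=(1,a_{33},a_{11},a_{11}a_{33}+a_{13}a_{31})$, $\mathsf e_2^{(2)}=(0,a_{23},0,a_{11}a_{23}+a_{13}a_{21})$, $\mathsf e_3^{(2)}=(0,0,a_{21},a_{21}a_{33}+a_{23}a_{31})$. In $\mathbf V_3$: $\mathsf f^{(3)}=\bigl(a_{13}a_{23},\ a_{23}(a_{12}a_{23}+a_{13}a_{22}),\ a_{13}(a_{11}a_{23}+a_{13}a_{21}),\ (a_{12}a_{23}+a_{13}a_{22})(a_{11}a_{23}+a_{13}a_{21})\bigr)$, $\mathsf e_1^{(3)}=(0,a_{32},0,a_{11}a_{32}+a_{12}a_{31})$, $\mathsf e_2^{(3)}=(1,a_{22},a_{11},a_{11}a_{22}+a_{12}a_{21})$, $\mathsf e_3^{(3)}=(0,0,a_{31},a_{21}a_{32}+a_{22}a_{31})$. *)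

(* Defs.v *)
From mathcomp Require Import all_boot all_order all_algebra.

Set Implicit Arguments.
Unset Strict Implicit.
Unset Printing Implicit Defensive.

Import GRing.Theory.
Local Open Scope ring_scope.

(* Axes are numbered by 'I_3, so a_{ij} with 1 <= i, j <= 3 is A (i-1) (j-1).  *)

Notation cube := {ffun 'I_3 -> bool}.

Definition cube_le (x y : cube) : bool := [forall i, (x i <= y i)%N].

(* A line parallel to axis i is the pair (i, k) with k : 'I_4 the rank of its
   two constant coordinates in the order (0,0), (0,1), (1,0), (1,1); the
   constant coordinates are those of index lift i 0 < lift i 1.  This is the k
   of the line parallel to axis i through x.                                  *)
Definition line_of (i : 'I_3) (x : cube) : 'I_4 :=
  let c (j : 'I_2) : nat := x (lift i j) in inord (2 * c 0%R + c 1%R)%N.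

(* The direct sum of the three thick spaces is 'rV_(3 * 4): the coordinate
   attached to the line (i, k) has index mxvec_index i k.                     *)
Definition line_index (i : 'I_3) (k : 'I_4) : 'I_(3 * 4) := mxvec_index i k.

Definition in_thick (F : fieldType) (i : 'I_3) (v : 'rV[F]_4) :
    'rV[F]_(3 * 4) :=
  \sum_(k < 4) v 0 k *: delta_mx 0 (line_index i k).

(* A acting on the three lines through x, plus the identity on the others.    *)
Definition copy_at (F : fieldType) (A : 'M[F]_3) (x : cube) : 'M[F]_(3 * 4) :=
  (\sum_(i < 3) \sum_(j < 3)
     A i j *: delta_mx (line_index i (line_of i x)) (line_index j (line_of j x)))
  + (\sum_(i < 3) \sum_(k < 4 | k != line_of i x)
     delta_mx (line_index i k) (line_index i k)).

Definition admissible (s : seq cube) : Prop :=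
  perm_eq s (enum {: cube}) /\
  forall x y : cube, x != y -> cube_le x y -> (index x s < index y s)%N.

Definition block (F : fieldType) (A : 'M[F]_3) (s : seq cube) :
    'M[F]_(3 * 4) :=
  \prod_(x <- s) copy_at A x.

Definition row4 (F : fieldType) (x0 x1 x2 x3 : F) : 'rV[F]_4 :=
  \row_(k < 4) [:: x0; x1; x2; x3]`_k.

Section Vectors.
Variables (F : fieldType) (A : 'M[F]_3).

Local Notation a11 := (A 0 0).
Local Notation a12 := (A 0 1).
Local Notation a13 := (A 0 2).
Local Notation a21 := (A 1 0).
Local Notation a22 := (A 1 1).
Local Notation a23 := (A 1 2).
Local Notation a31 := (A 2 0).
Local Notation a32 := (A 2 1).
Local Notation a33 := (A 2 2).

Definition fvec (i : 'I_3) : 'rV[F]_4 :=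
  match val i with
  | 0 => row4 (a21 * a31)
              (a31 * (a21 * a33 + a23 * a31))
              (a21 * (a21 * a32 + a22 * a31))
              ((a21 * a33 + a23 * a31) * (a21 * a32 + a22 * a31))
  | 1 => row4 (a12 * a32)
              (a32 * (a12 * a33 + a13 * a32))
              (a12 * (a11 * a32 + a12 * a31))
              ((a12 * a33 + a13 * a32) * (a11 * a32 + a12 * a31))
  | _ => row4 (a13 * a23)
              (a23 * (a12 * a23 + a13 * a22))
              (a13 * (a11 * a23 + a13 * a21))
              ((a12 * a23 + a13 * a22) * (a11 * a23 + a13 * a21))
  end.

(* evec s i is e_{s+1}^{(i+1)}, a vector of the thick space of axis i.        *)
Definition evec (s i : 'I_3) : 'rV[F]_4 :=
  match val i, val s with
  | 0, 0 => row4 0 0 a12 (a12 * a33 + a13 * a32)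
  | 0, 1 => row4 0 a13 0 (a12 * a23 + a13 * a22)
  | 0, _ => row4 1 a33 a22 (a22 * a33 + a23 * a32)
  | 1, 0 => row4 1 a33 a11 (a11 * a33 + a13 * a31)
  | 1, 1 => row4 0 a23 0 (a11 * a23 + a13 * a21)
  | 1, _ => row4 0 0 a21 (a21 * a33 + a23 * a31)
  | _, 0 => row4 0 a32 0 (a11 * a32 + a12 * a31)
  | _, 1 => row4 1 a22 a11 (a11 * a22 + a12 * a21)
  | _, _ => row4 0 0 a31 (a21 * a32 + a22 * a31)
  end.

End Vectors.

Definition sqmx (F : fieldType) (A : 'M[F]_3) : 'M[F]_3 :=
  map_mx (fun a => a ^+ 2) A.

(* Rows: f^(1), f^(2), f^(3), then e_s^(1), e_s^(2), e_s^(3) for s = 1, 2, 3. *)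
Definition basis_mx (F : fieldType) (A : 'M[F]_3) :
    'M[F]_(3 + \sum_(s < 3) 3, 3 * 4) :=
  col_mx (\matrix_(i < 3) in_thick i (fvec A i))
         (\mxcol_(s < 3) (\matrix_(i < 3) in_thick i (evec A s i))).

Definition squares_mx (F : fieldType) (A : 'M[F]_3) :
    'M[F]_(3 + \sum_(s < 3) 3) :=
  block_mx (sqmx A)^T 0 0 (\mxdiag_(s < 3) sqmx A).

(* Main.v *)
Require Import Defs.
From mathcomp Require Import all_boot all_order all_algebra.
From mathcomp Require Import mpoly ring.
Import GRing.Theory.
Local Open Scope ring_scope.

(** A row vector fed into the block is transported from vertex to vertex: each
    copy of A replaces the three values entering a vertex by the three values
    leaving it.  Because an admissible order visits the lower vertex of every
    line first, the result depends only on a labelling u k x of the edges (the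
    value entering x along axis k) satisfying the local rule [is_flow]; the
    block maps the initial labels to the final ones, whatever the order
    ([block_flow]).  It remains to exhibit one flow for each vector.

    For e_s^(i) there is a closed form.  Let L_l = sum_r a_rl X_r be the linear
    form of column l, let t be the cyclic successor of s, and identify a vertex
    x with the monomial of its nonzero coordinates.  The coordinates of e_s^(i)
    are the coefficients of x X_i in X_t prod_(l in x) L_l, and the flow is
      u k x = coefficient of x X_i^2 in X_k X_t prod_(l in x) L_l.
    The rule at a vertex is then the definition of L_l, and what leaves the
    upper vertex of a line along axis k contains the factor L_k^2.  In
    characteristic 2 this is sum_r a_rk^2 X_r^2, and X_i is the only variable
    whose exponent in the extracted monomial reaches 2: only a_ik^2 survives
    ([e_flow_final]).

    The vector f^(i) is orthogonal to the analogues of the e_t^(i) for the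
    transposed matrix and the reversed cube, whose block is the transpose of
    the given one; this is why the f^(i) span an invariant complement.  Its
    flow is short enough to be written down and checked modulo 2
    ([f_flow_final]).

    Finally the four vectors of a thick space have determinant
    (a_12 a_23 a_31 - a_13 a_32 a_21)^2, so the hypothesis on A makes them a
    basis ([det_thick_basis]). *)

Set Implicit Arguments.
Unset Strict Implicit.
Unset Printing Implicit Defensive.

(** * Lines of the cube *)

Definition set_coord (x : cube) (i : 'I_3) (b : bool) : cube :=
  [ffun l => if l == i then b else x l].

Lemma set_coord_id x i : set_coord x i (x i) = x.
Proof. by apply/ffunP=> l; rewrite ffunE; case: eqP => [->|]. Qed.

Lemma set_coord_same x i b : set_coord x i b i = b.
Proof. by rewrite ffunE eqxx. Qed.

Lemma set_coordK x i b c : set_coord (set_coord x i b) i c = set_coord x i c.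
Proof. by apply/ffunP=> l; rewrite !ffunE; case: eqP. Qed.

(** Points of one line are compared through their common upper end, which spares
    the ranks in 'I_4 from here on. *)
Lemma line_of_eq i x y :
  (line_of i x == line_of i y) = (set_coord x i true == set_coord y i true).
Proof.
apply/eqP/eqP => [/(congr1 val) | /ffunP exy].
  have lt4 (z : cube) : (2 * z (lift i 0%R) + z (lift i 1%R) < 4)%N.
    by case: (z _); case: (z _).
  rewrite !val_insubd !lt4 => e.
  have [e0 e1] : x (lift i 0) = y (lift i 0) /\ x (lift i 1) = y (lift i 1).
    by move: e; do 4!case: (_ (lift i _)).
  apply/ffunP=> l; rewrite !ffunE; case: eqP => // /eqP.
  rewrite eq_sym => /unlift_some[m -> _].
  by case: m => [[|[|//]] lt]; [move: e0 | move: e1];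
    congr (x (lift i _) = y (lift i _)); apply/val_inj.
have exy' (m : 'I_2) : x (lift i m) = y (lift i m).
  by have := exy (lift i m); rewrite !ffunE eq_sym (negbTE (neq_lift i m)).
by rewrite /line_of !exy'.
Qed.

Lemma line_of_surj i (k : 'I_4) : exists x : cube, k = line_of i x.
Proof.
pose b0 := (2 <= k)%N; pose b1 := odd k.
exists [ffun l => if l == lift i 0 then b0 else b1].
apply/val_inj; rewrite /line_of !ffunE eqxx (inj_eq lift_inj) /= inordK.
  by rewrite /b0 /b1; case: k b0 b1 => [[|[|[|[|]]]]].
by case: b0; case: b1.
Qed.

Lemma thick_eqP (F : fieldType) (v w : 'rV[F]_(3 * 4)) :
  (forall i x, v 0 (line_index i (line_of i x))
             = w 0 (line_index i (line_of i x))) -> v = w.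
Proof.
move=> evw; apply/rowP=> l; case/mxvec_indexP: l => i k.
by have [x ->] := line_of_surj i k; apply: evw.
Qed.

Lemma line_index_eq i j k l :
  (line_index i k == line_index j l) = (i == j) && (k == l).
Proof.
rewrite /line_index; apply/eqP/andP => [e|[/eqP-> /eqP->]//].
by have [] := (enum_rank_inj (cast_ord_inj e)); split; apply/eqP.
Qed.

Lemma in_thick_coord (F : fieldType) i (v : 'rV[F]_4) j k :
  in_thick i v 0 (line_index j k) = if j == i then v 0 k else 0.
Proof.
rewrite /in_thick summxE; case: eqP => [-> | /eqP nji].
  rewrite (bigD1 k) //= !mxE !eqxx mulr1 big1 ?addr0 // => l nlk.
  by rewrite !mxE line_index_eq !eqxx /= eq_sym (negbTE nlk) mulr0.
by rewrite big1 // => l _; rewrite !mxE line_index_eq (negbTE nji) !andbF mulr0.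
Qed.

Lemma thick_sum_coord (F : fieldType) (c : 'I_3 -> F)
    (v : 'I_3 -> 'rV[F]_4) l k :
  (\sum_j c j *: in_thick j (v j)) 0 (line_index l k) = c l * v l 0 k.
Proof.
rewrite summxE (bigD1 l) //= mxE in_thick_coord eqxx big1 ?addr0 // => j njl.
by rewrite mxE in_thick_coord eq_sym (negbTE njl) mulr0.
Qed.

Lemma in_thick_sum (F : fieldType) i n (c : 'I_n -> F) (v : 'I_n -> 'rV[F]_4) :
  in_thick i (\sum_r c r *: v r) = \sum_r c r *: in_thick i (v r).
Proof.
rewrite /in_thick; under [RHS]eq_bigr => r _ do rewrite scaler_sumr.
rewrite exchange_big; apply: eq_bigr => k _ /=.
rewrite summxE scaler_suml; apply: eq_bigr => r _.
by rewrite mxE scalerA.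
Qed.

(** * Propagation through the block *)

Lemma mul_delta_mx_coord (F : fieldType) n p (v : 'rV[F]_n) a b (c : 'I_p) :
  (v *m delta_mx a b) 0 c = v 0 a * (c == b)%:R.
Proof.
rewrite mxE (bigD1 a) //= mxE eqxx big1 ?addr0 // => l nla.
by rewrite mxE (negbTE nla) mulr0.
Qed.

Lemma mul_scale_delta_mx_coord (F : fieldType) n p (v : 'rV[F]_n) x a b
    (c : 'I_p) :
  (v *m (x *: delta_mx a b)) 0 c = v 0 a * x * (c == b)%:R.
Proof. by rewrite -scalemxAr mxE mul_delta_mx_coord mulrCA mulrA. Qed.

Lemma copy_at_coord (F : fieldType) (A : 'M[F]_3) x (v : 'rV_(3 * 4)) j k :
  (v *m copy_at A x) 0 (line_index j k) =
    if k == line_of j x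
    then \sum_i v 0 (line_index i (line_of i x)) * A i j
    else v 0 (line_index j k).
Proof.
rewrite /copy_at mulmxDr mxE !mulmx_sumr !summxE.
rewrite [X in _ + X](bigD1 j) //= [X in _ + (_ + X)]big1 ?addr0; last first.
  move=> i nij; rewrite mulmx_sumr summxE big1 // => l _.
  by rewrite mul_delta_mx_coord line_index_eq eq_sym (negbTE nij) mulr0.
under eq_bigr => i _.
  rewrite mulmx_sumr summxE (bigD1 j) //= big1 ?addr0 => [|l nlj]; last first.
    rewrite mul_scale_delta_mx_coord line_index_eq eq_sym.
    by rewrite (negbTE nlj) mulr0.
  rewrite mul_scale_delta_mx_coord line_index_eq eqxx /=.
  over.
rewrite -mulr_suml mulmx_sumr summxE.
under [X in _ + X]eq_bigr => l _ do
  rewrite mul_delta_mx_coord line_index_eq eqxx /=.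
have [-> | nk] := eqVneq k (line_of j x).
  rewrite mulr1 [X in _ + X]big1 ?addr0 // => l nl.
  by rewrite eq_sym (negbTE nl) mulr0.
rewrite mulr0 add0r (bigD1 k) //= eqxx mulr1 big1 ?addr0 // => l /andP[_ nl].
by rewrite eq_sym (negbTE nl) mulr0.
Qed.

Section Flow.
Variables (F : fieldType) (A : 'M[F]_3).

Definition flow_out (u : 'I_3 -> cube -> F) (j : 'I_3) (x : cube) : F :=
  \sum_i u i x * A i j.

(** What leaves a lower vertex is what enters the upper vertex of the same line;
    the values entering lower vertices are unconstrained initial data. *)
Definition is_flow (u : 'I_3 -> cube -> F) : Prop :=
  forall j (x : cube), ~~ x j -> u j (set_coord x j true) = flow_out u j x.

(** The value carried by the line through x along axis i once the vertices of p
    have acted.  Only membership in p matters, hence the independence of the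
    order. *)
Definition flow_state u (p : seq cube) (i : 'I_3) (x : cube) : F :=
  let x0 := set_coord x i false in let x1 := set_coord x i true in
  if x1 \in p then flow_out u i x1 else u i (if x0 \in p then x1 else x0).

(** By induction on prefixes of s, the current vector is [flow_state]: when z
    acts, admissibility says that the vertices below z have acted and those
    above have not, so its three lines carry exactly the values u j z. *)
Lemma block_flow u (v w : 'rV[F]_(3 * 4)) s :
    is_flow u -> admissible s ->
    (forall i (x : cube), ~~ x i -> v 0 (line_index i (line_of i x)) = u i x) ->
    (forall i (x : cube), ~~ x i ->
       w 0 (line_index i (line_of i x)) = flow_out u i (set_coord x i true)) ->
  v *m block A s = w.
Proof.
move=> flow_u [perm_s ord_s] in_v out_w.
have s_all x : x \in s by rewrite (perm_mem perm_s) mem_enum.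
have uniq_s : uniq s by rewrite (perm_uniq perm_s) enum_uniq.
have line_set i x b : line_of i (set_coord x i b) = line_of i x.
  by apply/eqP; rewrite line_of_eq set_coordK.
suff state p q i x : s = p ++ q ->
    (v *m \prod_(y <- p) copy_at A y) 0 (line_index i (line_of i x))
    = flow_state u p i x.
  apply: thick_eqP => i x; rewrite (state s [::]) ?cats0 // /flow_state s_all.
  by rewrite -(line_set i x false) out_w ?set_coordK ?set_coord_same.
elim/last_ind: p q i x => [|p z IHp] q i x def_s.
  rewrite big_nil mulmx1 /flow_state -(line_set i x false).
  by rewrite in_v ?set_coord_same.
rewrite cat_rcons in def_s.
have -> : \prod_(y <- rcons p z) copy_at A y
          = (\prod_(y <- p) copy_at A y) *m copy_at A z.
  by rewrite -cats1 big_cat big_seq1.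
rewrite mulmxA copy_at_coord.
have idx y : (index y s < size p)%N = (y \in p).
  rewrite def_s index_cat; case: ifP => [|_]; first by rewrite index_mem.
  by rewrite ltnNge leq_addr.
have z_notin_p : z \notin p.
  by move: uniq_s; rewrite def_s cat_uniq /= => /and3P[_ /norP[]].
have idx_z : index z s = size p.
  by rewrite def_s index_cat (negbTE z_notin_p) /= eqxx addn0.
(* The vertices below z precede it in s, hence belong to p; those above do
   not. *)
have below y : cube_le y z -> y != z -> y \in p.
  by move=> le ne; rewrite -idx -idx_z ord_s.
have above y : cube_le z y -> y != z -> y \notin p.
  by move=> le ne; rewrite -idx -idx_z -leqNgt ltnW // ord_s // eq_sym.
have lower j y : cube_le (set_coord y j false) y.
  by apply/forallP=> l; rewrite ffunE; case: eqP.
have upper j y : cube_le y (set_coord y j true).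
  by apply/forallP=> l; rewrite ffunE; case: eqP; rewrite ?leq_b1.
have in_z j : flow_state u p j z = u j z.
  rewrite /flow_state; case zj: (z j).
    have -> : set_coord z j true = z by rewrite -zj set_coord_id.
    rewrite (negbTE z_notin_p) below //.
    by apply/eqP => /ffunP/(_ j); rewrite set_coord_same zj.
  have -> : set_coord z j false = z by rewrite -zj set_coord_id.
  rewrite (negbTE z_notin_p) ifN // above //.
  by apply/eqP => /ffunP/(_ j); rewrite set_coord_same zj.
rewrite line_of_eq; case: eqP => [exz | nexz].
  under [LHS]eq_bigr => j _ do rewrite (IHp _ _ _ def_s) in_z.
  have exz' b : set_coord x i b = set_coord z i b.
    by rewrite -(set_coordK x i true) exz set_coordK.
  rewrite /flow_state !exz' !mem_rcons !inE; case zi: (z i).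
    have -> : set_coord z i true = z by rewrite -zi set_coord_id.
    by rewrite eqxx.
  have -> : set_coord z i false = z by rewrite -zi set_coord_id.
  have ne : set_coord z i true != z.
    by apply/eqP => /ffunP/(_ i); rewrite set_coord_same zi.
  by rewrite (negbTE ne) (negbTE (above _ _ ne)) // eqxx flow_u ?zi.
rewrite (IHp _ _ _ def_s) /flow_state !mem_rcons !inE.
suff nez b : (set_coord x i b == z) = false by rewrite !nez.
by apply/eqP => e; apply: nexz; rewrite -e set_coordK.
Qed.

End Flow.

(** * The three axes *)

(** The formulas below are symmetric under permutations of the axes, so they are
    stated for an arbitrary numbering i, j, k of the three axes. *)
Section Axes.
Variables (i j k : 'I_3).
Hypothesis ijk : uniq [:: i; j; k].

Lemma axes_perm : perm_eq [:: i; j; k] (index_enum 'I_3).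
Proof.
apply: uniq_perm => //; first exact: index_enum_uniq.
have [||_ //] := @uniq_min_size _ _ (index_enum 'I_3) ijk.
- by move=> l _; rewrite mem_index_enum.
- by rewrite /index_enum unlock -enumT size_enum_ord.
Qed.

Lemma big_axes (R : Type) (idx : R) (op : Monoid.com_law idx) (P : pred 'I_3)
    (G : 'I_3 -> R) :
  \big[op/idx]_(l | P l) G l =
  op (if P i then G i else idx)
     (op (if P j then G j else idx) (if P k then G k else idx)).
Proof.
by rewrite -(perm_big _ axes_perm) big_mkcond !big_cons big_nil Monoid.mulm1.
Qed.

Lemma sum_axes (V : nmodType) (G : 'I_3 -> V) : \sum_l G l = G i + (G j + G k).
Proof. by rewrite (big_axes _ predT). Qed.

Lemma axes_neq : ((i == j) = false) * ((j == i) = false) * ((i == k) = false)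
  * ((k == i) = false) * ((j == k) = false) * ((k == j) = false).
Proof.
move: ijk; rewrite /= !inE negb_or andbT => /andP[/andP[nij nik] njk].
by do !split; apply/negbTE; rewrite // eq_sym.
Qed.

Lemma mnm_eq_axes (m m' : 'X_{1..3}) :
  (m == m') = [&& m i == m' i, m j == m' j & m k == m' k].
Proof.
apply/eqP/and3P => [->//|[/eqP ei /eqP ej /eqP ek]]; apply/mnmP=> l.
have : l \in index_enum 'I_3 by rewrite mem_index_enum.
by rewrite -(perm_mem axes_perm) !inE => /or3P[] /eqP->.
Qed.

Lemma axesP (P : 'I_3 -> Prop) : P i -> P j -> P k -> forall l, P l.
Proof.
move=> Pi Pj Pk l; have := mem_index_enum l.
by rewrite -(perm_mem axes_perm) !inE => /or3P[] /eqP->.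
Qed.

End Axes.

(** * Flows of the vectors e *)

Section EFlow.
Variables (F : fieldType) (A : 'M[F]_3).

Definition col_form (l : 'I_3) : {mpoly F[3]} := \sum_r A r l *: 'X_r.

Definition col_forms (x : cube) : {mpoly F[3]} := \prod_(l | x l) col_form l.

Definition cube_mnm (x : cube) : 'X_{1..3} := [multinom x l : nat | l < 3].

(** The coordinate of e_s^(i), with t = s + 1, on the line along axis i through
    x (see [evec_line]). *)
Definition e_coef (t i : 'I_3) (x : cube) : F :=
  ('X_t * col_forms x)@_(cube_mnm x + U_(i)).

(** The coefficient of X^x X_i^2 / (X_k X_t) in the product of the column forms;
    moving X_k and X_t to the other side keeps every exponent natural. *)
Definition e_flow (t i k : 'I_3) (x : cube) : F :=
  ('X_k * ('X_t * col_forms x))@_(cube_mnm x + U_(i) + U_(i)).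

Lemma mcoeff_mulX_lt (P : {mpoly F[3]}) (m m' : 'X_{1..3}) (l : 'I_3) :
  (m l < m' l)%N -> ('X_[m'] * P)@_m = 0.
Proof.
move=> ltm; apply/eqP; rewrite mulrC mcoeff_eq0 (perm_mem (msuppMX _ _)).
by apply/mapP=> -[m1 _ def_m]; move: ltm; rewrite def_m mnmDE ltnNge leq_addr.
Qed.

Lemma mcoeff_mulX (P : {mpoly F[3]}) m m' : ('X_[m'] * P)@_(m + m') = P@_m.
Proof. by rewrite mulrC addmC mcoeffMX. Qed.

Lemma col_forms_set_coord (x : cube) j : ~~ x j ->
  col_forms (set_coord x j true) = col_form j * col_forms x /\
  cube_mnm (set_coord x j true) = (cube_mnm x + U_(j))%MM.
Proof.
move=> xj; split.
  rewrite /col_forms (bigD1 j) ?set_coord_same //=; congr (_ * _).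
  apply: eq_bigl => l; rewrite ffunE; case: eqVneq => [->|_] /=.
    by rewrite (negbTE xj).
  by rewrite andbT.
apply/mnmP=> l; rewrite mnmDE !mnmE ffunE (eq_sym j).
by case: eqP => [->|_]; rewrite ?(negbTE xj) ?addn0.
Qed.

Lemma e_flow_out t i j x :
  flow_out A (e_flow t i) j x
  = (col_form j * ('X_t * col_forms x))@_(cube_mnm x + U_(i) + U_(i)).
Proof.
rewrite /flow_out /col_form mulr_suml (raddf_sum (mcoeff _)).
by apply: eq_bigr => r _; rewrite -scalerAl /= mcoeffZ mulrC.
Qed.

Lemma e_flowP t i : is_flow A (e_flow t i).
Proof.
move=> j x xj; have [def_p def_m] := col_forms_set_coord xj.
rewrite e_flow_out /e_flow def_p def_m -!addmA [(U_(j) + _)%MM]addmC !addmA.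
by rewrite mcoeff_mulX mulrCA.
Qed.

(** For k != i the variable X_k does not occur in X^x X_i^2, so that the flow
    starts from a vector of the i-th thick space only. *)
Lemma e_flow_in t i k (x : cube) : ~~ x k ->
  e_flow t i k x = if k == i then e_coef t i x else 0.
Proof.
move=> xk; case: eqP => [-> | /eqP nki]; first by rewrite /e_flow mcoeff_mulX.
apply: (@mcoeff_mulX_lt _ _ _ k).
by rewrite !mnmDE mnmE !mnm1E eqxx (negbTE xk) eq_sym (negbTE nki).
Qed.

Lemma col_form_sqr j : 2%N \in [pchar F] ->
  col_form j ^+ 2 = \sum_r A r j ^+ 2 *: 'X_r ^+ 2.
Proof.
move=> charF; have charP : 2%N \in [pchar {mpoly F[3]}] by rewrite pchar_lalg.
rewrite -(pFrobenius_autE charP) rmorph_sum /=.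
by apply: eq_bigr => r _; rewrite pFrobenius_autE exprZn.
Qed.

(** The second visit of a line turns L_k into L_k^2, which has no cross terms;
    X_r^2 divides X^x X_k X_i^2 only if r = i. *)
Lemma e_flow_final t i k (x : cube) : 2%N \in [pchar F] -> ~~ x k ->
  flow_out A (e_flow t i) k (set_coord x k true) = A i k ^+ 2 * e_coef t k x.
Proof.
move=> charF xk; have [def_p def_m] := col_forms_set_coord xk.
rewrite e_flow_out def_p def_m ['X_t * _]mulrCA (mulrA (col_form k)) -expr2.
rewrite col_form_sqr // mulr_suml (raddf_sum (mcoeff _)) (bigD1 i) //=.
rewrite [X in _ + X]big1 => [|r nri].
  rewrite addr0 -scalerAl /= mcoeffZ ['X_i ^+ 2]expr2 -(mulrA 'X_i).
  by rewrite !mcoeff_mulX.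
rewrite -scalerAl /= mcoeffZ ['X_r ^+ 2]expr2 -mpolyXD.
rewrite (@mcoeff_mulX_lt _ _ _ r) ?mulr0 //.
rewrite !mnmDE !mnm1E mnmE eqxx ![i == r]eq_sym (negbTE nri) !addn0.
by case: eqP => [<-|_]; rewrite ?(negbTE xk) ?addn0 // ltnS leq_b1.
Qed.
End EFlow.

Section ECoordinates.
Variables (i j k : 'I_3).
Hypothesis ijk : uniq [:: i; j; k].
Variables (F : fieldType) (A : 'M[F]_3) (x : cube).
Hypothesis xi : ~~ x i.

Lemma col_forms_axes :
  col_forms A x = (if x j then col_form A j else 1)
                  * (if x k then col_form A k else 1).
Proof. by rewrite /col_forms (big_axes ijk) /= (negbTE xi) mul1r. Qed.

Let mcoeff_eval := (mcoeffD, mcoeffZ, mcoeffX, mnm_eq_axes ijk, @mnmDE 3,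
  @mnm1E 3, @mnmE 3, eqxx, axes_neq ijk, addn0, mulr0, mulr1, add0r, addr0).

(** With t = i these are the principal minors on the nonzero coordinates of x;
    with t = j the row t is replaced by i.  In characteristic 2 permanents and
    determinants agree, so the signs are all positive. *)
Lemma e_coef_own :
  e_coef A i i x =
    if x j then if x k then A j j * A k k + A j k * A k j else A j j
    else if x k then A k k else 1.
Proof.
rewrite /e_coef col_forms_axes /col_form !(sum_axes ijk).
case xj: (x j); case xk: (x k); rewrite ?mulr1 ?mul1r
   ?mulrDl ?mulrDr -?scalerAl -?scalerAr -?scalerAl -?mpolyXD;
  rewrite !mcoeff_eval ?xj ?xk ?(negbTE xi) /=; ring.
Qed.

Lemma e_coef_other :
  e_coef A j i x =
    if x j then if x k then A i j * A k k + A i k * A k j else A i j else 0.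
Proof.
rewrite /e_coef col_forms_axes /col_form !(sum_axes ijk).
case xj: (x j); case xk: (x k); rewrite ?mulr1 ?mul1r
   ?mulrDl ?mulrDr -?scalerAl -?scalerAr -?scalerAl -?mpolyXD;
  rewrite !mcoeff_eval ?xj ?xk ?(negbTE xi) /=; ring.
Qed.
End ECoordinates.

(** * Flows of the vectors f *)

(** The reduction of the numeral coefficients met below; [ring] replaces a
    coefficient only when it is listed literally. *)
Lemma pchar2_natr (R : nzRingType) : 2%N \in [pchar R] ->
  [/\ 2%:R = 0 :> R, 3%:R = 1 :> R, 4%:R = 0 :> R & 6%:R = 0 :> R].
Proof.
move=> charR; have two0 : 2%:R = 0 :> R by apply: pcharf0.
by split; rewrite ?(natrD _ 2 1) ?(natrM _ 2 2) ?(natrM _ 2 3) two0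
  ?add0r ?mul0r.
Qed.

Section FFlow.
Variables (F : fieldType) (A : 'M[F]_3).

(** The permanent of A on rows j, k and columns i, j, which in characteristic 2
    is the minor. *)
Definition f_minor (i j k : 'I_3) : F := A j i * A k j + A j j * A k i.

(** The coordinate of f^(i) on the line along axis i through x, see [fvec_line]:
    a product of two factors, one for each of the other axes. *)
Definition f_coef (i j k : 'I_3) (x : cube) : F :=
  (if x k then f_minor i k j else A j i) *
  (if x j then f_minor i j k else A k i).

Lemma f_coef_axes i j k m n x : uniq [:: i; j; k] -> uniq [:: i; m; n] ->
  f_coef i m n x = f_coef i j k x.
Proof.
move=> ijk imn; have [ne ne'] := (axes_neq ijk, axes_neq imn).
move: m n imn ne'; apply: (axesP ijk); [| | ];
  apply: (axesP ijk); rewrite ?eqxx ?ne => _ [[[[[]]]]] // *.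
by rewrite /f_coef mulrC.
Qed.

Variables (i j k : 'I_3).
Hypothesis ijk : uniq [:: i; j; k].

(** The value entering x along axis j when x j holds, obtained by letting f^(i)
    pass through the vertices below x; the same formula with j and k exchanged
    serves axis k. *)
Definition f_side (j k : 'I_3) (x : cube) : F :=
  let p := A j i in let q := A k i in
  if x k then
    if x i then
      q * (f_minor i k j * A i i + p * q * A i k) * A i j
      + p * q * A i i * A i k * A k j
    else q * (f_minor i k j * A i j + p * A i k * A k j)
  else p * q * A i j * (if x i then A i i else 1).

Definition f_flow (l : 'I_3) (x : cube) : F :=
  let p := A j i in let q := A k i in
  if l == i then
    if ~~ x i then f_coef i j k x
    else if x j then
      if x k then f_minor i j k * f_minor i k j * A i i
         + p * (q * (f_minor i k j * A i j + p * A i k * A k j))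
         + q * (p * (f_minor i j k * A i k + q * A i j * A j k))
      else p * (f_minor i j k * A i i + p * q * A i j)
    else q * (if x k then f_minor i k j * A i i + p * q * A i k else p * A i i)
  else if ~~ x l then 0
  else if l == j then f_side j k x else f_side k j x.

Lemma f_flowP : is_flow A f_flow.
Proof.
move=> l x; move: l; apply: (axesP ijk); rewrite /flow_out (sum_axes ijk);
  rewrite /f_flow /f_side /f_coef !eqxx !(axes_neq ijk) /f_minor;
  rewrite !ffunE ?eqxx !(axes_neq ijk);
  case: (x i); case: (x j); case: (x k) => //= _; ring.
Qed.

(** This and [det_thick_basis] are the places where the vectors f use
    characteristic 2: every cross term occurs an even number of times. *)
Lemma f_flow_final l m n (x : cube) : 2%N \in [pchar F] ->
    uniq [:: l; m; n] -> ~~ x l ->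
  flow_out A f_flow l (set_coord x l true) = A l i ^+ 2 * f_coef l m n x.
Proof.
move=> charF; have [two0 three1 four0 _] := pchar2_natr charF.
have jik : uniq [:: j; i; k] by rewrite /= !inE !(axes_neq ijk).
have kij : uniq [:: k; i; j] by rewrite /= !inE !(axes_neq ijk).
have all_out : [/\ ~~ x i -> flow_out A f_flow i (set_coord x i true)
                             = A i i ^+ 2 * f_coef i j k x,
                  ~~ x j -> flow_out A f_flow j (set_coord x j true)
                             = A j i ^+ 2 * f_coef j i k x
                & ~~ x k -> flow_out A f_flow k (set_coord x k true)
                             = A k i ^+ 2 * f_coef k i j x].
  split; rewrite /flow_out (sum_axes ijk);
    rewrite /f_flow /f_side /f_coef !eqxx !(axes_neq ijk) /f_minor;
    rewrite !ffunE ?eqxx !(axes_neq ijk);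
    case: (x i); case: (x j); case: (x k) => //= _; ring: two0 three1 four0.
case: all_out => out_i out_j out_k; move: l; apply: (axesP ijk) => lmn xl.
- by rewrite (f_coef_axes _ ijk lmn) out_i.
- by rewrite (f_coef_axes _ jik lmn) out_j.
- by rewrite (f_coef_axes _ kij lmn) out_k.
Qed.

End FFlow.

(** * Coordinates of the given vectors *)

Lemma row4_line (F : fieldType) (a b c d : F) i (x : cube) :
  row4 a b c d 0 (line_of i x) =
    if x (lift i 0%R) then if x (lift i 1%R) then d else c
    else if x (lift i 1%R) then b else a.
Proof.
rewrite mxE val_insubd.
by case: (x (lift i 0%R)); case: (x (lift i 1%R)).
Qed.

Lemma ord3P (P : 'I_3 -> Prop) : P 0 -> P 1 -> P 2 -> forall i, P i.
Proof. by move=> P0 P1 P2; apply: axesP P0 P1 P2. Qed.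

Lemma lift3 :
  ((lift 0 0 = 1 :> 'I_3) * (lift 0 1 = 2 :> 'I_3)) *
  ((lift 1 0 = 0 :> 'I_3) * (lift 1 1 = 2 :> 'I_3)) *
  ((lift 2 0 = 0 :> 'I_3) * (lift 2 1 = 1 :> 'I_3)).
Proof. by do !split; apply/val_inj. Qed.

Lemma uniq_lift (i : 'I_3) : uniq [:: i; lift i 0; lift i 1].
Proof.
by rewrite /= !inE !(negbTE (neq_lift _ _)) (inj_eq lift_inj).
Qed.

Section Vectors.
Variables (F : fieldType) (A : 'M[F]_3).

Lemma fvec_line i x :
  fvec A i 0 (line_of i x) = f_coef A i (lift i 0) (lift i 1) x.
Proof.
by elim/ord3P: i; rewrite /fvec row4_line /f_coef /f_minor !lift3;
  case: (x _); case: (x _); rewrite //=; ring.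
Qed.

Lemma evec_line s i (x : cube) : ~~ x i ->
  evec A s i 0 (line_of i x) = e_coef A (s + 1) i x.
Proof.
(* Addition in 'I_3 is modulo 3. *)
have [s0 s1 s2] : [/\ 0 + 1 = 1 :> 'I_3, 1 + 1 = 2 :> 'I_3 & 2 + 1 = 0 :> 'I_3].
  by split; apply/val_inj.
pose e_coefE i j k (ijk : uniq [:: i; j; k]) (ikj : uniq [:: i; k; j]) xi :=
  (@e_coef_own i j k ijk F A x xi, @e_coef_other i j k ijk F A x xi,
   @e_coef_other i k j ikj F A x xi).
elim/ord3P: i => xi; elim/ord3P: s; rewrite /evec row4_line !lift3 ?s0 ?s1 ?s2;
  rewrite ?(e_coefE 0 1 2 isT isT xi) ?(e_coefE 1 0 2 isT isT xi)
    ?(e_coefE 2 0 1 isT isT xi);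
  case: (x _); case: (x _); rewrite //=; ring.
Qed.

End Vectors.

(** * Bases of the thick spaces *)

Definition rows4 (F : fieldType) (X : seq 'rV[F]_4) : 'M[F]_4 :=
  \matrix_(r < 4) X`_r.

Lemma det_thick_basis (F : fieldType) (A : 'M[F]_3) (i : 'I_3) :
  2%N \in [pchar F] ->
  \det (rows4 [:: fvec A i; evec A 0 i; evec A 1 i; evec A 2 i])
  = (A 0 1 * A 1 2 * A 2 0 - A 0 2 * A 2 1 * A 1 0) ^+ 2.
Proof.
move=> charF; have [two0 three1 four0 six0] := pchar2_natr charF.
do 3!rewrite !(expand_det_row _ 0) !big_ord_recl !big_ord0 /cofactor.
(* In characteristic 2 the signs of the cofactors disappear. *)
rewrite !det_mx11 !mxE !(oppr_pchar2 charF) !expr1n !mul1r.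
elim/ord3P: i; rewrite /fvec /evec /= !mxE /=;
  rewrite !(mul0r, mulr0, add0r, addr0, mul1r, mulr1);
  ring: two0 three1 four0 six0.
Qed.

Lemma basis_of_thick (F : fieldType) (A : 'M[F]_3) (i : 'I_3) :
  2%N \in [pchar F] ->
  A 0 1 * A 1 2 * A 2 0 != A 0 2 * A 2 1 * A 1 0 ->
  basis_of fullv [:: fvec A i; evec A 0 i; evec A 1 i; evec A 2 i].
Proof.
move=> charF hA; set X := [:: _; _; _; _].
rewrite basisEfree subvf dimvf /dim /= mul1n leqnn !andbT.
apply/(@freeP _ _ _ (in_tuple X)) => c cX0 r.
have unitX : rows4 X \in unitmx.
  by rewrite unitmxE det_thick_basis // unitfE expf_neq0 // subr_eq0.
have : \row_r c r = 0.
  rewrite -(mulmxK unitX (\row_r c r)) (_ : _ *m rows4 X = 0) ?mul0mx //.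
  rewrite -[RHS]cX0 mulmx_sum_row; apply: eq_bigr => l _.
  by rewrite mxE rowK.
by move/rowP/(_ r); rewrite !mxE.
Qed.

Lemma basis_mx_full (F : fieldType) (A : 'M[F]_3) :
  (forall i : 'I_3,
     basis_of fullv [:: fvec A i; evec A 0 i; evec A 1 i; evec A 2 i]) ->
  row_full (basis_mx A).
Proof.
move=> basis_i.
(* The row space contains the four basis vectors of each thick space, hence
   every coordinate vector. *)
have [/row_subP sub_f sub_e] :
    ((\matrix_(i < 3) in_thick i (fvec A i) <= basis_mx A)%MS /\
     forall t, (\matrix_(i < 3) in_thick i (evec A t i) <= basis_mx A)%MS).
  have := submx_refl (basis_mx A); rewrite {1}/basis_mx col_mx_sub.
  move=> /andP[? sub_e]; split=> // t; apply: submx_trans sub_e.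
  pose E t := \matrix_(i < 3) in_thick i (evec A t i).
  by rewrite -[X in (X <= _)%MS](mxcolK E); apply: rowsub_sub.
have {}sub_f i : (in_thick i (fvec A i) <= basis_mx A)%MS.
  by have := sub_f i; rewrite rowK.
have {}sub_e t i : (in_thick i (evec A t i) <= basis_mx A)%MS.
  by have /row_subP/(_ i) := sub_e t; rewrite rowK.
rewrite -sub1mx; apply/row_subP=> l; rewrite row1.
case/mxvec_indexP: l => i k.
have -> : delta_mx 0 (mxvec_index i k) = in_thick i (delta_mx 0 k : 'rV[F]_4).
  rewrite /in_thick (bigD1 k) //= mxE !eqxx scale1r big1 ?addr0 // => l nlk.
  by rewrite mxE (negbTE nlk) andbF scale0r.
set X := [:: fvec A i; evec A 0 i; evec A 1 i; evec A 2 i].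
have in_span : delta_mx 0 k \in <<in_tuple X>>%VS.
  by rewrite (span_basis (basis_i i)) memvf.
rewrite (coord_span in_span) in_thick_sum; apply: summx_sub => r _.
by apply: scalemx_sub; case: r => [[|[|[|[|//]]]] lt] /=.
Qed.

(** The number of rows is 3 + 3 * 3, the same as the number of columns. *)
Lemma basis_mx_free (F : fieldType) (A : 'M[F]_3) :
  row_full (basis_mx A) -> row_free (basis_mx A).
Proof.
rewrite /row_full /row_free => /eqP->.
by rewrite sum_nat_const card_ord.
Qed.

(** * Action of the block *)

Lemma f_block (F : fieldType) (A : 'M[F]_3) s i :
  2%N \in [pchar F] -> admissible s ->
  in_thick i (fvec A i) *m block A s
  = \sum_(j < 3) A j i ^+ 2 *: in_thick j (fvec A j).
Proof.
move=> charF adm_s; have u3 := uniq_lift i.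
apply: (block_flow (f_flowP A u3) adm_s) => l x xl.
  rewrite in_thick_coord /f_flow xl.
  by move: xl; case: eqP => [-> ->|_ _] //; rewrite fvec_line.
by rewrite thick_sum_coord fvec_line (f_flow_final _ u3 charF (uniq_lift l)).
Qed.

Lemma e_block (F : fieldType) (A : 'M[F]_3) s t i :
  2%N \in [pchar F] -> admissible s ->
  in_thick i (evec A t i) *m block A s
  = \sum_(j < 3) A i j ^+ 2 *: in_thick j (evec A t j).
Proof.
move=> charF adm_s.
apply: (block_flow (e_flowP A (t + 1) i) adm_s) => l x xl.
  rewrite in_thick_coord e_flow_in //.
  by move: xl; case: eqP => [-> xi|//]; rewrite evec_line.
by rewrite thick_sum_coord evec_line // e_flow_final.
Qed.

Lemma basis_mx_block (F : fieldType) (A : 'M[F]_3) s :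
  2%N \in [pchar F] -> admissible s ->
  basis_mx A *m block A s = squares_mx A *m basis_mx A.
Proof.
move=> charF adm_s.
have rows_mul (C : 'M[F]_3) (v : 'I_3 -> 'rV_4) :
  (forall i, in_thick i (v i) *m block A s
             = \sum_(j < 3) C i j *: in_thick j (v j)) ->
  (\matrix_(i < 3) in_thick i (v i)) *m block A s
  = C *m \matrix_(i < 3) in_thick i (v i).
  move=> vR; apply/row_matrixP=> i; rewrite !row_mul rowK vR mulmx_sum_row.
  by apply: eq_bigr => j _; rewrite rowK mxE.
rewrite /basis_mx /squares_mx mul_col_mx mul_block_col !mul0mx addr0 add0r.
congr col_mx.
  apply: rows_mul => i; rewrite f_block //.
  by apply: eq_bigr => j _; rewrite !mxE.
rewrite mxcol_mul mul_mxdiag_mxcol; apply: eq_mxcol => t.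
apply: rows_mul => i; rewrite e_block //.
by apply: eq_bigr => j _; rewrite !mxE.
Qed.

Theorem proposition10 (F : finFieldType) (charF : 2%N \in [pchar F])
    (A : 'M[F]_3)
    (hA : A 0 1 * A 1 2 * A 2 0 != A 0 2 * A 2 1 * A 1 0)
    (s : seq cube) (hs : admissible s) :
  [/\ forall i : 'I_3,
        basis_of fullv [:: fvec A i; evec A 0 i; evec A 1 i; evec A 2 i],
      row_free (basis_mx A) && row_full (basis_mx A),
      basis_mx A *m block A s = squares_mx A *m basis_mx A,
      forall i : 'I_3,
        in_thick i (fvec A i) *m block A s
        = \sum_(j < 3) A j i ^+ 2 *: in_thick j (fvec A j)
    & forall i t : 'I_3,
        in_thick i (evec A t i) *m block A s
        = \sum_(j < 3) A i j ^+ 2 *: in_thick j (evec A t j)].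
Proof.
have basis_i i := basis_of_thick i charF hA.
have full := basis_mx_full basis_i.
split=> //; first by rewrite basis_mx_free.
- exact: basis_mx_block.
- by move=> i; apply: f_block.
- by move=> i t; apply: e_block.
Qed.
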